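(* Let $(X,\tau)$ be a completely regular topological space. Then there exists a symmetric continuity space $(V,X,d)$ (a continuity space with $d(x,y)=d(y,x)$ for all $x,y\in X$) such that the topology on $X$ generated by $(V,X,d)$ is $\tau$.
   Context: For a complete lattice $L$ with bottom $\bot$ and $x,y\in L$, write $y\succ x$ (equivalently $x\prec y$; ''$y$ is well above $x$'') if whenever $S\subseteq L$ and $x\ge\bigwedge S$, there is $s\in S$ with $y\ge s$. A value distributive lattice is a completely distributive complete lattice $L$ for which $L_\prec=\{a\in L\mid a\succ\bot\}$ is a filter. A value quantale is a value distributive lattice $V$ with an associative commutative binary operation $+:V\times V\to V$ such that $x+\bot=x$ for all $x\in V$ and $\bigwedge(x+S)=x+\bigwedge S$ for all $x\in V$, $S\subseteq V$. A continuity space $(V,X,d)$ consists of a value quantale $V$, a set $X$ and a function $d:X\times X\to V$ with $d(x,x)=\bot$ and $d(x,z)\le d(x,y)+d(y,z)$ for all $x,y,z\in X$. For $\epsilon\succ\bot$ put $B_\epsilon(x)=\{y\in X\mid d(x,y)\prec\epsilon\}$. The topology generated by $(V,X,d)$, denoted $\mathcal{O}[(V,X,d)]$, consists of those $U\subseteq X$ such that for every $x\in U$ there is $\epsilon\succ\bot$ with $B_\epsilon(x)\subseteq U$. A topology is completely regular if points and closed sets not containing them can be separated by continuous $[0,1]$-valued functions; no separation axiom such as $T_0$ or $T_1$ is included. *)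

(* Defs.v *)
From HB Require Import structures.
From mathcomp Require Import all_boot all_order all_algebra.
From mathcomp Require Import all_classical all_reals all_analysis.
Import Order.TTheory GRing.Theory Num.Theory numFieldNormedType.Exports.

Set Implicit Arguments.
Unset Strict Implicit.
Unset Printing Implicit Defensive.

Local Open Scope classical_set_scope.
Local Open Scope order_scope.

HB.mixin Record TBLattice_isComplete (d : Order.disp_t) L
    & Order.TBLattice d L := {
  infimums_exist : forall S : set L, infimums S !=set0 ;
  supremums_exist : forall S : set L, supremums S !=set0
}.

#[short(type="completeLatticeType")]
HB.structure Definition CompleteLattice (d : Order.disp_t) :=
  {L of Order.TBLattice d L & TBLattice_isComplete d L}.

(* The first argument of [infimum] (resp. [supremum]) is its value at the empty
   set, so that the meet of the empty set is the top element and its join is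
   the bottom element. *)
Definition bigmeet (d : Order.disp_t) (L : completeLatticeType d) (S : set L)
  : L := infimum \top S.

Definition bigjoin (d : Order.disp_t) (L : completeLatticeType d) (S : set L)
  : L := supremum \bot S.

Lemma bigmeetP (d : Order.disp_t) (L : completeLatticeType d) (S : set L) :
  infimums S (bigmeet S).
Proof.
rewrite /bigmeet /infimum; case: ifPn => [/eqP ->|_].
  by split=> [x []|y _]; exact: lex1.
by have [x Sx] := infimums_exist S; exact: xgetI Sx.
Qed.

Lemma bigjoinP (d : Order.disp_t) (L : completeLatticeType d) (S : set L) :
  supremums S (bigjoin S).
Proof.
rewrite /bigjoin /supremum; case: ifPn => [/eqP ->|_].
  by split=> [x []|y _]; exact: le0x.
by have [x Sx] := supremums_exist S; exact: xgetI Sx.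
Qed.

Definition completely_distributive (d : Order.disp_t)
    (L : completeLatticeType d) : Prop :=
  forall (I : Type) (J : I -> Type) (f : forall i : I, J i -> L),
    bigmeet (range (fun i : I => bigjoin (range (f i)))) =
    bigjoin (range (fun c : forall i : I, J i =>
                      bigmeet (range (fun i : I => f i (c i))))).

(* [well_above y x] stands for $y \succ x$. *)
Definition well_above (d : Order.disp_t) (L : completeLatticeType d)
    (y x : L) : Prop :=
  forall S : set L, bigmeet S <= x -> exists2 s, S s & s <= y.

(* Filters are nonempty but may be improper: in the two-element lattice, the
   bottom element is well above itself. *)
Definition lattice_filter (d : Order.disp_t) (L : latticeType d) (F : set L)
  : Prop :=
  [/\ F !=set0,
      forall a b : L, F a -> a <= b -> F b
    & forall a b : L, F a -> F b -> F (a `&` b)].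

HB.mixin Record CompleteLattice_isValueDistributive (d : Order.disp_t) L
    & CompleteLattice d L := {
  complete_distributivity : completely_distributive L ;
  well_above_bot_filter : lattice_filter [set a : L | well_above a \bot]
}.

#[short(type="valueDistrLatticeType")]
HB.structure Definition ValueDistrLattice (d : Order.disp_t) :=
  {L of CompleteLattice d L & CompleteLattice_isValueDistributive d L}.

HB.mixin Record ValueDistrLattice_isValueQuantale (d : Order.disp_t) V
    & ValueDistrLattice d V := {
  vadd : V -> V -> V ;
  vaddA : associative vadd ;
  vaddC : commutative vadd ;
  vaddx0 : right_id \bot vadd ;
  vadd_bigmeetr : forall (x : V) (S : set V),
    bigmeet (vadd x @` S) = vadd x (bigmeet S)
}.

#[short(type="valueQuantaleType")]
HB.structure Definition ValueQuantale (d : Order.disp_t) :=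
  {V of ValueDistrLattice d V & ValueDistrLattice_isValueQuantale d V}.

Definition continuity_space (disp : Order.disp_t) (V : valueQuantaleType disp)
    (X : Type) (d : X -> X -> V) : Prop :=
  (forall x : X, d x x = \bot) /\
  (forall x y z : X, d x z <= vadd (d x y) (d y z)).

Definition vball (disp : Order.disp_t) (V : valueQuantaleType disp)
    (X : Type) (d : X -> X -> V) (eps : V) (x : X) : set X :=
  [set y | well_above eps (d x y)].

Definition generated_topology (disp : Order.disp_t)
    (V : valueQuantaleType disp) (X : Type) (d : X -> X -> V) : set (set X) :=
  [set U | forall x : X, U x ->
     exists2 eps : V, well_above eps \bot & vball d eps x `<=` U].

(* The library's [completely_regular_space] separates by means of a uniformity;
   separation by real functions is equivalent to it, as proved below. *)
Definition completely_regular (R : realType) (X : topologicalType) : Prop :=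
  forall (x : X) (C : set X), closed C -> ~ C x ->
    exists f : X -> R,
      [/\ continuous f,
          forall y : X, (0 <= f y <= 1)%R,
          f x = 0%R
        & forall y : X, C y -> f y = 1%R].

Lemma completely_regularP (R : realType) (X : topologicalType) :
  completely_regular R X <-> completely_regular_space X.
Proof.
split=> crX x C clC nCx.
- apply/(@uniform_separatorP X R); have [f [cf f01 fx fC]] := crX x C clC nCx.
  exists f; split=> //.
  + by move=> _ [y _ <-]; rewrite /= in_itv /=; exact: f01.
  + by move=> _ [_ -> <-].
  + by move=> _ [y Cy <-]; exact: fC.
- have [f [cf f01 fx fC]] := (@uniform_separatorP X R _ _).1 (crX x C clC nCx).
  exists f; split=> //.
  + by move=> y; have := f01 (f y) (ex_intro2 _ _ y I erefl);
      rewrite /= in_itv.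
  + by apply: fx; exists x.
  + by move=> y Cy; apply: fC; exists y.
Qed.

(* Main.v *)
Require Import Defs.
From HB Require Import structures.
From mathcomp Require Import all_boot all_order all_algebra.
From mathcomp Require Import all_classical all_reals all_analysis.
From mathcomp Require Import lra.
Import Order.TTheory GRing.Theory Num.Theory numFieldNormedType.Exports.

Set Implicit Arguments.
Unset Strict Implicit.
Unset Printing Implicit Defensive.

Local Open Scope classical_set_scope.
Local Open Scope order_scope.
Local Open Scope ring_scope.

(** A completely regular topology is the topology of its continuous
    pseudometrics: if U is an open neighbourhood of x and f is a continuous
    [0,1]-valued function with f x = 0 and f = 1 outside U, then |f y - f z|
    is a continuous pseudometric whose ball of radius 1 around x lies in U. So
    let D be the set of all continuous pseudometrics on X bounded by 1, and
    let the distance of x and y be the function rho |-> rho x y on D. It is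
    symmetric and satisfies the triangle inequality because each rho does;
    what remains is to find a value quantale in which it takes its values.

    The full power [0,1]^D is not one as soon as D has two elements: only
    elements equal to 1 at all coordinates but one are well above the bottom
    there, and these are not closed under binary meets. The remedy is to use
    that D is directed for the pointwise order and that rho |-> rho x y is
    monotone. The monotone functions D -> [0,1] form a complete sublattice of
    the power, with meets and joins computed pointwise, hence a completely
    distributive lattice ([gauge_completely_distributive]), and truncated
    addition min 1 (v + w) preserves monotonicity and commutes with pointwise
    infima ([gauge_add_bigmeetr]). Being well above the bottom now means lying
    above a step function, equal to some a > 0 on the elements below some rho
    of D and to 1 elsewhere ([well_above_step], [well_above_bot_step]). The
    step function at an upper bound of two elements of D, with the smaller of
    two heights, lies below both corresponding step functions, which yields
    the filter property ([gauge_well_above_bot_filter]).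

    Finally, the ball whose radius is the step function at rho of height a
    contains the rho-ball of radius a and lies in the closed one, so the
    generated topology is the topology of the family D ([nbhs_vball_cpm_dist],
    [generated_topology_cpm_dist]). *)

(** * The well above relation *)

Lemma well_aboveW (disp : Order.disp_t) (L : completeLatticeType disp)
    (x y z : L) : well_above y x -> (y <= z)%O -> well_above z x.
Proof.
by move=> yx yz S /yx[s Ss sy]; exists s => //; exact: le_trans yz.
Qed.

Lemma well_above_ge (disp : Order.disp_t) (L : completeLatticeType disp)
    (x y : L) : well_above y x -> (x <= y)%O.
Proof.
move=> /(_ [set x])[|_ -> //].
by apply: (bigmeetP _).1.
Qed.

(** * The value quantale of monotone functions into the unit interval *)

Record directedPreorder := DirectedPreorder {
  dcarrier :> Type ;
  dle : dcarrier -> dcarrier -> Prop ;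
  dle_refl : forall t, dle t t ;
  dle_trans : forall t u v, dle t u -> dle u v -> dle t v ;
  dle_directed : forall t u, exists v, dle t v /\ dle u v ;
  dle_inhabited : inhabited dcarrier
}.

(** When T is a set of pseudometrics ordered pointwise, the distances between
    two fixed points in all of them form a gauge; this is the meaning of
    monotonicity. *)
Record gauge (R : realType) (T : directedPreorder) := Gauge {
  gauge_fun :> T -> R ;
  gauge01 : forall t, 0 <= gauge_fun t <= 1 ;
  gauge_mono : forall t u, dle t u -> gauge_fun t <= gauge_fun u
}.

Section GaugeLattice.
Context {R : realType} {T : directedPreorder}.
Local Notation V := (gauge R T).
Implicit Types (v w : V) (S : set V) (t u : T) (a : R).

Lemma gauge_ge0 v t : 0 <= v t. Proof. by case/andP: (gauge01 v t). Qed.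
Lemma gauge_le1 v t : v t <= 1. Proof. by case/andP: (gauge01 v t). Qed.

Lemma gauge_ext v w : (forall t, v t = w t) -> v = w.
Proof.
case: v w => [f f01 fm] [g g01 gm] /= /funext fg.
by subst g; congr Gauge; exact: Prop_irrelevance.
Qed.

HB.instance Definition _ := gen_eqMixin V.
HB.instance Definition _ := gen_choiceMixin V.

Definition gauge_le v w : bool := `[< forall t, v t <= w t >].

Lemma gauge_le_refl : reflexive gauge_le.
Proof. by move=> v; apply/asboolP. Qed.

Lemma gauge_le_anti : antisymmetric gauge_le.
Proof.
move=> v w /andP[/asboolP vw /asboolP wv].
by apply: gauge_ext => t; apply/le_anti; rewrite vw wv.
Qed.

Lemma gauge_le_trans : transitive gauge_le.
Proof.
move=> w v x /asboolP vw /asboolP wx; apply/asboolP => t.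
exact: le_trans (vw t) (wx t).
Qed.

HB.instance Definition _ := Order.Le_isPOrder.Build (Order.Disp tt tt) V
  gauge_le_refl gauge_le_anti gauge_le_trans.

Lemma gauge_leP v w : reflect (forall t, v t <= w t) (v <= w)%O.
Proof. exact: asboolP. Qed.

Program Definition gauge_meet v w : V :=
  @Gauge R T (fun t => Num.min (v t) (w t)) _ _.
Next Obligation.
by move=> v w t; rewrite le_min ge_min !gauge_ge0 gauge_le1.
Qed.
Next Obligation.
by move=> v w t u tu; rewrite le_min !ge_min !gauge_mono ?orbT.
Qed.

Program Definition gauge_join v w : V :=
  @Gauge R T (fun t => Num.max (v t) (w t)) _ _.
Next Obligation.
by move=> v w t; rewrite le_max ge_max !gauge_ge0 !gauge_le1.
Qed.
Next Obligation.
by move=> v w t u tu; rewrite ge_max !le_max !gauge_mono ?orbT.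
Qed.

Program Definition gauge_cst a (a01 : 0 <= a <= 1) : V :=
  @Gauge R T (fun=> a) _ _.
Next Obligation. by []. Qed.
Next Obligation. by []. Qed.

Lemma gauge_lexI v w x :
  (v <= gauge_meet w x)%O = (v <= w)%O && (v <= x)%O.
Proof.
apply/gauge_leP/andP => [vwx|[/gauge_leP vw /gauge_leP vx] t]; last first.
  by rewrite le_min vw vx.
by split; apply/gauge_leP => t; have := vwx t; rewrite le_min => /andP[].
Qed.

Lemma gauge_leUx v w x :
  (gauge_join v w <= x)%O = (v <= x)%O && (w <= x)%O.
Proof.
apply/gauge_leP/andP => [vwx|[/gauge_leP vx /gauge_leP wx] t]; last first.
  by rewrite ge_max vx wx.
by split; apply/gauge_leP => t; have := vwx t; rewrite ge_max => /andP[].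
Qed.

HB.instance Definition _ :=
  Order.POrder_MeetJoin_isLattice.Build (Order.Disp tt tt) V
    gauge_lexI gauge_leUx.

Fact zero01 : 0 <= (0 : R) <= 1. Proof. by rewrite lexx ler01. Qed.
Fact one01 : 0 <= (1 : R) <= 1. Proof. by rewrite lexx ler01. Qed.

Lemma gauge_le0x v : (gauge_cst zero01 <= v)%O.
Proof. by apply/gauge_leP => t; exact: gauge_ge0. Qed.

Lemma gauge_lex1 v : (v <= gauge_cst one01)%O.
Proof. by apply/gauge_leP => t; exact: gauge_le1. Qed.

HB.instance Definition _ :=
  Order.hasBottom.Build (Order.Disp tt tt) V gauge_le0x.
HB.instance Definition _ :=
  Order.hasTop.Build (Order.Disp tt tt) V gauge_lex1.

(** With 1 (resp. 0) adjoined, the real infimum (resp. supremum) of the values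
    at t of the empty set is the top (resp. bottom) of [0,1]. *)
Let values1 S t : set R := 1 |` [set v t | v in S].
Let values0 S t : set R := 0 |` [set v t | v in S].

Lemma values1_ge0 S t : lbound (values1 S t) 0.
Proof. by move=> _ [->|[v _ <-]] //; exact: gauge_ge0. Qed.

Lemma values0_le1 S t : ubound (values0 S t) 1.
Proof. by move=> _ [->|[v _ <-]] //; exact: gauge_le1. Qed.

Lemma inf_values1_le S t a : values1 S t a -> inf (values1 S t) <= a.
Proof. by apply: ge_inf; exists 0; exact: values1_ge0. Qed.

Lemma le_sup_values0 S t a : values0 S t a -> a <= sup (values0 S t).
Proof. by apply: ub_le_sup; exists 1; exact: values0_le1. Qed.

Lemma le_inf_values1 S t a :
  a <= 1 -> (forall v, S v -> a <= v t) -> a <= inf (values1 S t).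
Proof.
move=> a1 aS; apply: lb_le_inf; first by exists 1; left.
by move=> _ [->|[v Sv <-]] //; exact: aS.
Qed.

Lemma sup_values0_le S t a :
  0 <= a -> (forall v, S v -> v t <= a) -> sup (values0 S t) <= a.
Proof.
move=> a0 aS; apply: ge_sup; first by exists 0; left.
by move=> _ [->|[v Sv <-]] //; exact: aS.
Qed.

Program Definition gauge_inf S : V :=
  @Gauge R T (fun t => inf (values1 S t)) _ _.
Next Obligation.
move=> S t; rewrite inf_values1_le ?andbT; last by left.
by apply: le_inf_values1 => // v _; exact: gauge_ge0.
Qed.
Next Obligation.
move=> S t u tu; apply: le_inf_values1 => [|v Sv].
  by apply: inf_values1_le; left.
by apply: le_trans (gauge_mono v tu); apply: inf_values1_le; right; exists v.
Qed.

Program Definition gauge_sup S : V :=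
  @Gauge R T (fun t => sup (values0 S t)) _ _.
Next Obligation.
move=> S t; rewrite le_sup_values0 ?andTb; last by left.
by apply: sup_values0_le => // v _; exact: gauge_le1.
Qed.
Next Obligation.
move=> S t u tu; apply: sup_values0_le => [|v Sv].
  by apply: le_sup_values0; left.
by apply: le_trans (gauge_mono v tu) _; apply: le_sup_values0; right; exists v.
Qed.

Lemma gauge_inf_infimums S : infimums S (gauge_inf S).
Proof.
split=> [v Sv|w wS]; apply/gauge_leP => t.
  by apply: inf_values1_le; right; exists v.
apply: le_inf_values1 => [|v Sv]; first exact: gauge_le1.
exact: (gauge_leP _ _ (wS v Sv)).
Qed.

Lemma gauge_sup_supremums S : supremums S (gauge_sup S).
Proof.
split=> [v Sv|w wS]; apply/gauge_leP => t.
  by apply: le_sup_values0; right; exists v.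
apply: sup_values0_le => [|v Sv]; first exact: gauge_ge0.
exact: (gauge_leP _ _ (wS v Sv)).
Qed.

HB.instance Definition _ :=
  TBLattice_isComplete.Build (Order.Disp tt tt) V
    (fun S => ex_intro _ _ (gauge_inf_infimums S))
    (fun S => ex_intro _ _ (gauge_sup_supremums S)).

Lemma bigmeet_gauge S : bigmeet S = gauge_inf S.
Proof.
exact: is_subset1_infimums (bigmeetP S) (gauge_inf_infimums S).
Qed.

Lemma bigjoin_gauge S : bigjoin S = gauge_sup S.
Proof.
exact: is_subset1_supremums (bigjoinP S) (gauge_sup_supremums S).
Qed.

Lemma bigmeet_gauge_le S v t : S v -> bigmeet S t <= v t.
Proof. by move=> Sv; have /gauge_leP := (bigmeetP S).1 v Sv; exact. Qed.

Lemma bigjoin_gauge_ge S v t : S v -> v t <= bigjoin S t.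
Proof. by move=> Sv; have /gauge_leP := (bigjoinP S).1 v Sv; exact. Qed.

(** Meets are pointwise infima, so a bound exceeding the value of a meet at t
    exceeds that of a member.  The condition [a <= 1] excludes the empty S,
    whose meet is 1 everywhere. *)
Lemma bigmeet_gauge_lt S t a :
  a <= 1 -> bigmeet S t < a -> exists2 v, S v & v t < a.
Proof.
move=> a1; rewrite bigmeet_gauge ltNge; apply: contraNP => nS.
apply: le_inf_values1 => // v Sv; rewrite leNgt; apply/negP => va.
by apply: nS; exists v.
Qed.

Lemma bigjoin_gauge_gt S t a :
  0 <= a -> a < bigjoin S t -> exists2 v, S v & a < v t.
Proof.
move=> a0; rewrite bigjoin_gauge ltNge; apply: contraNP => nS.
apply: sup_values0_le => // v Sv; rewrite leNgt; apply/negP => va.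
by apply: nS; exists v.
Qed.

(** Only the inequality from the meet of joins to the join of meets has content.
    If it fails at t, insert a number b strictly between the two sides there.
    For every i some f i k exceeds b at t, and a choice function c of such k
    makes the meet of the f i (c i) at least b at t, although that meet is
    below the join of meets. *)
Lemma gauge_completely_distributive : completely_distributive V.
Proof.
move=> I J f; apply/le_anti/andP; split; last first.
  apply: (bigjoinP _).2 => _ [c _ <-]; apply: (bigmeetP _).2 => _ [i _ <-].
  apply: (@le_trans _ _ (f i (c i))).
    by apply: (bigmeetP _).1; exists i.
  by apply: (bigjoinP _).1; exists (c i).
apply/gauge_leP => t; set m := (X in X t <= _); set j := (X in _ <= X t).
rewrite leNgt; apply/negP => jm; pose b := (j t + m t) / 2.
have [jb bm] : j t < b /\ b < m t by rewrite /b; split; lra.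
have b0 : 0 <= b by apply: le_trans (ltW jb); exact: gauge_ge0.
have b1 : b <= 1 by apply: le_trans (ltW bm) _; exact: gauge_le1.
have pick i : exists k : J i, b < f i k t.
  have [|_ [k _ <-] bk] := @bigjoin_gauge_gt (range (f i)) t b b0.
    apply: lt_le_trans bm _; apply: bigmeet_gauge_le.
    by exists i.
  by exists k.
pose c i := projT1 (cid (pick i)).
have : bigmeet (range (fun i => f i (c i))) t <= j t.
  by apply: bigjoin_gauge_ge; exists c.
move=> /le_lt_trans/(_ jb)/(bigmeet_gauge_lt b1)[_ [i _ <-]].
by rewrite ltNge ltW // /c; case: cid.
Qed.

(** The step functions generate the filter of the elements well above the
    bottom: [gauge_step t a] is the largest gauge with value at most a at t
    (see [gauge_le_step]). *)
Definition step_fun t a u : R := if `[< dle u t >] then a else 1.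

Program Definition gauge_step t a (a01 : 0 <= a <= 1) : V :=
  @Gauge R T (step_fun t a) _ _.
Next Obligation.
by move=> t a a01 u; rewrite /step_fun; case: asboolP => // _; exact: one01.
Qed.
Next Obligation.
move=> t a /andP[a0 a1] u u' uu'; rewrite /step_fun.
case: asboolP => [ut|nut]; first by case: asboolP.
by case: asboolP => // u't; case: nut; exact: dle_trans u't.
Qed.

Lemma gauge_le_step v t a (a01 : 0 <= a <= 1) :
  (v <= gauge_step t a01)%O = (v t <= a).
Proof.
apply/gauge_leP/idP => [/(_ t)|va u] /=; rewrite /step_fun.
  by rewrite asboolT //; exact: dle_refl.
case: asboolP => [ut|_]; last exact: gauge_le1.
exact: le_trans (gauge_mono v ut) va.
Qed.

(** If the meet of S is below v and v t < a, then the value at t of some member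
    of S is less than a, and that single inequality already puts the member
    below the step function. *)
Lemma well_above_step v t a (a01 : 0 <= a <= 1) :
  v t < a -> well_above (gauge_step t a01) v.
Proof.
move=> va S Sv; have [||s Ss sa] := @bigmeet_gauge_lt S t a.
- by case/andP: a01.
- by apply: le_lt_trans va; move/gauge_leP: Sv; exact.
- by exists s => //; rewrite gauge_le_step ltW.
Qed.

(** Conversely, the step functions of positive height have meet bottom, since
    their heights at each t are arbitrarily small; so whatever is well above
    bottom is above one of them. *)
Lemma well_above_bot_step v : well_above v \bot ->
  exists t a (a01 : 0 <= a <= 1), 0 < a /\ (gauge_step t a01 <= v)%O.
Proof.
pose S : set V :=
  [set w | exists t a (a01 : 0 <= a <= 1), 0 < a /\ w = gauge_step t a01].
move=> /(_ S)[|_ [t [a [a01 [a0 ->]]]] av]; last by exists t, a, a01.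
apply/gauge_leP => t; rewrite leNgt; apply/negP => m0.
(* The meet of S is below the step at t of half its own value at t, which is
   absurd if this value is positive. *)
have m01 : 0 <= bigmeet S t / 2 <= 1.
  by have := gauge_le1 (bigmeet S) t; move: m0 => /=; lra.
have : bigmeet S t <= gauge_step t m01 t.
  apply: bigmeet_gauge_le; exists t, (bigmeet S t / 2), m01; split=> //.
  by move: m0 => /=; lra.
rewrite /= /step_fun asboolT; last exact: dle_refl.
by move: m0 => /=; lra.
Qed.

(** Directedness of T is used here: step functions at t and u have as common
    lower bound the one at an upper bound of t and u. *)
Lemma gauge_well_above_bot_filter :
  lattice_filter [set v : V | well_above v \bot].
Proof.
split=> [|v w /= v0 vw|v w /= v0 w0].
- case: (dle_inhabited T) => t; exists (gauge_step t one01).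
  by apply: well_above_step; exact: ltr01.
- exact: well_aboveW v0 vw.
- have [t [a [a01 [a0 av]]]] := well_above_bot_step v0.
  have [u [b [b01 [b0 bw]]]] := well_above_bot_step w0.
  have [s [ts us]] := dle_directed t u.
  have ab01 : 0 <= Num.min a b <= 1.
    have /andP[ge0a le1a] := a01; have /andP[ge0b _] := b01.
    by rewrite le_min ge_min ge0a ge0b le1a.
  apply: (@well_aboveW _ _ _ (gauge_step s ab01)).
    by apply: well_above_step; rewrite /= lt_min a0.
  rewrite lexI; apply/andP; split.
    apply: le_trans av; rewrite gauge_le_step /= /step_fun.
    by rewrite asboolT // ge_min lexx.
  apply: le_trans bw; rewrite gauge_le_step /= /step_fun.
  by rewrite asboolT // ge_min lexx orbT.
Qed.

HB.instance Definition _ :=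
  CompleteLattice_isValueDistributive.Build (Order.Disp tt tt) V
    gauge_completely_distributive gauge_well_above_bot_filter.

Program Definition gauge_add v w : V :=
  @Gauge R T (fun t => Num.min 1 (v t + w t)) _ _.
Next Obligation.
by move=> v w t; rewrite le_min ge_min lexx ler01 addr_ge0 ?gauge_ge0.
Qed.
Next Obligation.
move=> v w t u tu; rewrite le_min !ge_min lexx /=.
by rewrite lerD ?orbT ?gauge_mono.
Qed.

Lemma gauge_addC : commutative gauge_add.
Proof. by move=> v w; apply: gauge_ext => t /=; rewrite addrC. Qed.

Lemma gauge_addA : associative gauge_add.
Proof.
move=> v w x; apply: gauge_ext => t /=.
have := gauge_ge0 v t; have := gauge_ge0 x t.
by rewrite !minEle; do 4 ?[case: ifPn; rewrite -?ltNge]; lra.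
Qed.

Lemma gauge_addx0 : right_id \bot gauge_add.
Proof.
by move=> v; apply: gauge_ext => t /=; rewrite addr0 min_r ?gauge_le1.
Qed.

(** The truncation at 1 keeps this true for empty S, where both sides are the
    top element. *)
Lemma gauge_add_bigmeetr v S :
  bigmeet (gauge_add v @` S) = gauge_add v (bigmeet S).
Proof.
apply/le_anti/andP; split; last first.
  apply: (bigmeetP _).2 => _ [w Sw <-]; apply/gauge_leP => t /=.
  rewrite le_min !ge_min lexx /=; apply/orP; right.
  by rewrite lerD2l bigmeet_gauge_le.
apply/gauge_leP => t /=; pose m := bigmeet S t; rewrite -/m.
rewrite le_min gauge_le1 /= leNgt -ltrBrDl; apply/negP => mlt.
have sum1 := gauge_le1 (bigmeet (gauge_add v @` S)) t.
have v0 := gauge_ge0 v t; rewrite -/m in sum1.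
have [|w Sw] := bigmeet_gauge_lt _ mlt; first by lra.
have : bigmeet (gauge_add v @` S) t <= gauge_add v w t.
  by apply: bigmeet_gauge_le; exists w.
by rewrite /= le_min => /andP[_]; lra.
Qed.

HB.instance Definition _ :=
  ValueDistrLattice_isValueQuantale.Build (Order.Disp tt tt) V
    gauge_addA gauge_addC gauge_addx0 gauge_add_bigmeetr.

End GaugeLattice.

(** * Continuous pseudometrics *)

(** Continuity is required only in the form that balls are neighbourhoods of
    their centres; for a pseudometric this is joint continuity, by the triangle
    inequality. *)
Record cpmetric (R : realType) (X : topologicalType) := CPMetric {
  cpm_fun :> X -> X -> R ;
  cpm01 : forall x y, 0 <= cpm_fun x y <= 1 ;
  cpmxx : forall x, cpm_fun x x = 0 ;
  cpmC : forall x y, cpm_fun x y = cpm_fun y x ;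
  cpm_triangle : forall x y z, cpm_fun x z <= cpm_fun x y + cpm_fun y z ;
  cpm_ball_nbhs : forall x a, 0 < a -> nbhs x [set y | cpm_fun x y < a]
}.

Section Cpmetric.
Context {R : realType} {X : topologicalType}.
Implicit Types rho : cpmetric R X.

Program Definition cpm_cst0 : cpmetric R X :=
  @CPMetric R X (fun _ _ => 0) _ _ _ _ _.
Next Obligation. by move=> *; exact: zero01. Qed.
Next Obligation. by []. Qed.
Next Obligation. by []. Qed.
Next Obligation. by move=> *; rewrite addr0. Qed.
Next Obligation. by move=> x a a0; apply: filterE. Qed.

Program Definition cpm_max rho1 rho2 : cpmetric R X :=
  @CPMetric R X (fun x y => Num.max (rho1 x y) (rho2 x y)) _ _ _ _ _.
Next Obligation.
move=> r1 r2 x y; have /andP[r10 r11] := cpm01 r1 x y.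
by have /andP[_ r21] := cpm01 r2 x y; rewrite le_max ge_max r10 r11.
Qed.
Next Obligation. by move=> r1 r2 x /=; rewrite !cpmxx maxxx. Qed.
Next Obligation. by move=> r1 r2 x y /=; rewrite (cpmC r1) (cpmC r2). Qed.
Next Obligation.
move=> r1 r2 x y z; rewrite ge_max; apply/andP; split.
  by apply: le_trans (cpm_triangle r1 x y z) _; rewrite lerD // le_max lexx.
by apply: le_trans (cpm_triangle r2 x y z) _; rewrite lerD // le_max lexx orbT.
Qed.
Next Obligation.
move=> r1 r2 x a a0.
apply: filterS2 (cpm_ball_nbhs r1 x a0) (cpm_ball_nbhs r2 x a0) => y /= y1 y2.
by rewrite gt_max y1.
Qed.

Program Definition cpm_of (f : X -> R) (cf : continuous f)
    (f01 : forall x, 0 <= f x <= 1) : cpmetric R X :=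
  @CPMetric R X (fun x y => `|f x - f y|) _ _ _ _ _.
Next Obligation.
move=> f cf f01 x y; have := f01 x; have := f01 y; rewrite normr_ge0 ler_norml.
by lra.
Qed.
Next Obligation. by move=> f cf f01 x /=; rewrite subrr normr0. Qed.
Next Obligation. by move=> f cf f01 x y /=; rewrite distrC. Qed.
Next Obligation. by move=> f cf f01 x y z; exact: ler_distD. Qed.
Next Obligation.
by move=> f cf f01 x a a0; move/cvgrPdist_lt: (cf x); apply.
Qed.

(** * The distance with values in the value quantale *)

Definition cpm_le rho1 rho2 : Prop := forall x y, rho1 x y <= rho2 x y.

Program Definition cpmetrics : directedPreorder :=
  @DirectedPreorder (cpmetric R X) cpm_le _ _ _ (inhabits cpm_cst0).
Next Obligation. by move=> rho x y; exact: lexx. Qed.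
Next Obligation.
by move=> r1 r2 r3 r12 r23 x y; apply: le_trans (r12 x y) _.
Qed.
Next Obligation.
move=> r1 r2; exists (cpm_max r1 r2).
by split=> x y /=; rewrite le_max lexx ?orbT.
Qed.

Program Definition cpm_dist (x y : X) : gauge R cpmetrics :=
  @Gauge R cpmetrics (fun rho => (rho : cpmetric R X) x y) _ _.
Next Obligation. by move=> x y rho; exact: cpm01. Qed.
Next Obligation. by move=> x y r1 r2; exact. Qed.

Lemma cpm_dist_continuity_space : continuity_space cpm_dist.
Proof.
split=> [x|x y z]; first by apply: gauge_ext => rho; exact: cpmxx.
apply/gauge_leP => rho /=; rewrite le_min cpm_triangle andbT.
by case/andP: (cpm01 rho x z).
Qed.

Lemma cpm_distC x y : cpm_dist x y = cpm_dist y x.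
Proof. by apply: gauge_ext => rho; exact: cpmC. Qed.

(** A radius well above the bottom is above a step function at some rho of some
    height a > 0, so the ball contains the rho-ball of radius a. *)
Lemma nbhs_vball_cpm_dist (eps : gauge R cpmetrics) x :
  well_above eps \bot -> nbhs x (vball cpm_dist eps x).
Proof.
move=> /well_above_bot_step[rho [a [a01 [a0 aeps]]]].
apply: filterS (cpm_ball_nbhs rho x a0) => y /= xya.
by apply: well_aboveW aeps; exact: well_above_step.
Qed.

Lemma generated_topology_cpm_dist :
  completely_regular R X -> generated_topology cpm_dist = @open X.
Proof.
move=> crX; apply/seteqP; split=> U.
  move=> genU; rewrite openE => x /genU[eps eps0 epsU].
  exact: filterS epsU (nbhs_vball_cpm_dist x eps0).
move=> oU x Ux; have [||f [cf f01 fx fU]] := crX x (~` U).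
- by rewrite closedC.
- exact.
(* A ball is only known to lie in the closed rho-ball of the same radius, and
   rho x y = 1 for y outside U: the radius must be less than 1. *)
have half01 : 0 <= (2^-1 : R) <= 1 by lra.
pose rho : cpmetrics := cpm_of cf f01.
exists (gauge_step rho half01).
  by apply: well_above_step; rewrite /= invr_gt0.
move=> y /well_above_ge; rewrite gauge_le_step /= fx => fy.
apply: contrapT => /fU fy1; move: fy; rewrite fy1 sub0r normrN normr1.
by lra.
Qed.

End Cpmetric.

Theorem lemma19 (R : realType) (X : topologicalType) :
  completely_regular R X ->
  exists (disp : Order.disp_t) (V : valueQuantaleType disp) (d : X -> X -> V),
    [/\ continuity_space d,
        forall x y : X, d x y = d y x
      & generated_topology d = @open X].
Proof.
move=> crX; exists (Order.Disp tt tt), (gauge R (@cpmetrics R X)), cpm_dist.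
split; first exact: cpm_dist_continuity_space.
  exact: cpm_distC.
exact: generated_topology_cpm_dist.
Qed.
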